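(* Let $(X,d)$ be a (nonempty) complete metric space, let $N\ge1$, let $\psi,\phi_1,\dots,\phi_N:(0,\infty)\to\mathbb{R}$ be nondecreasing functions, and let $w_1,\dots,w_N:X\to X$ be continuous maps such that for each $i=1,\dots,N$, $$\psi(d(w_i(x),w_i(y)))\le\phi_i(d(x,y))\quad\text{for all }x,y\in X\text{ with }d(w_i(x),w_i(y))>0.$$ Suppose that for each $i=1,\dots,N$: (i) $\phi_i(t)<\psi(t)$ for every $t>0$; (ii) $\limsup_{t\to\epsilon+}\phi_i(t)<\psi(\epsilon+)$ for every $\epsilon>0$. Then there exists a unique attractor $A^*\in\mathcal{H}(X)$ for the iterated function system $\{X;w_1,\dots,w_N\}$, i.e. a unique $A^*\in\mathcal{H}(X)$ with $W(A^* )=A^*$. Moreover, for any $A\in\mathcal{H}(X)$ the sequence $A_n=W^n(A)$ converges to $A^*$ in $(\mathcal{H}(X),h_d)$.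
   Context: $\mathcal{H}(X)$ is the set of all nonempty compact subsets of $X$, with the Hausdorff metric $h_d(A,B)=\max\{\max_{x\in A}\min_{y\in B}d(x,y),\ \max_{x\in B}\min_{y\in A}d(x,y)\}$. The fractal operator $W:\mathcal{H}(X)\to\mathcal{H}(X)$ of the system is $W(A)=\bigcup_{i=1}^N w_i(A)$, where $w_i(A)=\{w_i(a):a\in A\}$; $W^n$ is its $n$-fold composition. $\psi(\epsilon+)$ denotes the right-hand limit of $\psi$ at $\epsilon$. *)

(* Defs.v *)
From HB Require Import structures.
From mathcomp Require Import all_boot all_order all_algebra.
From mathcomp Require Import lra.
From mathcomp Require Import all_classical all_reals all_analysis.

Set Implicit Arguments.
Unset Strict Implicit.
Unset Printing Implicit Defensive.

Import Order.TTheory GRing.Theory Num.Theory.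
Import numFieldNormedType.Exports.

Local Open Scope classical_set_scope.
Local Open Scope ring_scope.

(* Complete structures are pointed in the library, so a completeMetricType is
   nonempty. *)
#[short(type="completeMetricType")]
HB.structure Definition CompleteMetric (K : numDomainType) :=
  { M of Metric K M & Complete M }.

Definition hyperspace (X : topologicalType) : set (set X) :=
  [set A | A !=set0 /\ compact A].
Arguments hyperspace : clear implicits.

Definition fractal_op (X : Type) (N : nat) (w : 'I_N -> X -> X) (A : set X) :
  set X := \bigcup_(i in [set: 'I_N]) (w i @` A).

Lemma fractal_op_hyperspace (X : topologicalType) (N : nat)
    (w : 'I_N -> X -> X) (A : set X) :
  (0 < N)%N -> (forall i, continuous (w i)) ->
  hyperspace X A -> hyperspace X (fractal_op w A).
Proof.
move=> N0 wc [[a Aa] cA]; split.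
  by exists (w (Ordinal N0) a); exists (Ordinal N0) => //; exists a.
have -> : fractal_op w A = \big[setU/set0]_(i < N) (w i @` A).
  by rewrite -(bigcup_pred xpredT); rewrite /fractal_op; congr bigcup; apply/seteqP.
apply: bigsetU_compact => i _.
by apply: continuous_compact cA; exact: continuous_subspaceT.
Qed.

Definition is_attractor (X : topologicalType) (N : nat) (w : 'I_N -> X -> X)
  (A : set X) : Prop := hyperspace X A /\ fractal_op w A = A.

Section hausdorff_distance.
Context {R : realType} {X : metricType R}.
Implicit Types (A B : set X) (x y : X).

Definition set_dist x B : R := inf [set mdist x y | y in B].

Definition excess A B : R := sup [set set_dist x B | x in A].

(* [inf] and [sup] are a minimum and a maximum on nonempty compact sets: see
   [set_dist_min] and [excess_max]. *)
Definition hausdorff_dist A B : R := Num.max (excess A B) (excess B A).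

Let lip_continuous (f : X -> R) :
  (forall x y, f x <= f y + mdist x y) -> continuous f.
Proof.
move=> lf x; apply/cvgrPdist_le => e e0.
near=> y.
have xy : mdist x y <= e.
  near: y; have := nbhsx_ballx x e e0; rewrite ballEmdist.
  by apply: filterS => y /= /ltW.
rewrite ler_norml; apply/andP; split.
  have := lf y x; rewrite metric_sym => h; lra.
have := lf x y => h; lra.
Unshelve. all: by end_near. Qed.

Lemma set_dist_min x B : hyperspace X B ->
  exists2 y, B y & set_dist x B = mdist x y /\
    forall z, B z -> mdist x y <= mdist x z.
Proof.
move=> [B0 cB].
have dc : continuous (mdist x).
  apply: lip_continuous => y z.
  by rewrite (metric_sym y z) metric_triangle.
have [y /set_mem By ymin] :=
  compact_EVT_min B0 cB (continuous_subspaceT dc).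
have {}ymin z : B z -> mdist x y <= mdist x z by move=> /mem_set /ymin.
exists y => //; split=> //; apply/eqP; rewrite eq_le; apply/andP; split.
  apply: ge_inf; last by exists y.
  by exists 0 => _ [z _ <-]; exact: mdist_ge0.
apply: lb_le_inf; first by exists (mdist x y), y.
by move=> _ [z /ymin ? <-].
Qed.

Lemma excess_max A B : hyperspace X A -> hyperspace X B ->
  exists2 x, A x & excess A B = set_dist x B /\
    forall z, A z -> set_dist z B <= set_dist x B.
Proof.
move=> [A0 cA] HB.
have dc : continuous (set_dist ^~ B).
  apply: lip_continuous => y z.
  have [v Bv [-> _]] := set_dist_min z HB.
  have [u Bu [-> umin]] := set_dist_min y HB.
  by rewrite addrC (le_trans (umin _ Bv)) ?metric_triangle.
have [x /set_mem Ax xmax] :=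
  compact_EVT_max A0 cA (continuous_subspaceT dc).
have {}xmax z : A z -> set_dist z B <= set_dist x B by move=> /mem_set /xmax.
exists x => //; split=> //; apply/eqP; rewrite eq_le; apply/andP; split.
  apply: ge_sup; first by exists (set_dist x B), x.
  by move=> _ [z /xmax ? <-].
apply: ub_le_sup; last by exists x.
by exists (set_dist x B) => _ [z /xmax ? <-].
Qed.

End hausdorff_distance.

(* Main.v *)
(* The hypotheses make the maps [w i] strictly contractive and, uniformly in
   [i], of Meir-Keeler type: for every [e > 0] there is [d > 0] such that points
   at distance less than [e + d] have images at distance at most [e] (otherwise
   [psi (e+) <= psi (d (w x) (w y)) <= phi (d x y)] with [d x y] close to [e+]).
   Since the Hausdorff distance is attained, the fractal operator inherits both
   properties on the hyperspace.  Hence the distance between any two orbits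
   decreases to [0], every orbit is Cauchy by the Meir-Keeler argument, and its
   limit in the complete hyperspace is the attractor. *)
Require Import Defs.
From HB Require Import structures.
From mathcomp Require Import all_boot all_order all_algebra.
From mathcomp Require Import lra.
From mathcomp Require Import all_classical all_reals all_analysis.

Set Implicit Arguments.
Unset Strict Implicit.
Unset Printing Implicit Defensive.

Import Order.TTheory GRing.Theory Num.Theory.
Import numFieldNormedType.Exports.

Local Open Scope classical_set_scope.
Local Open Scope ring_scope.

(** * The Hausdorff distance on nonempty compact sets *)

Section hausdorff_distance_theory.
Context {R : realType} {X : metricType R}.
Implicit Types A B C : set X.

Lemma excess_le A B (r : R) : hyperspace X A -> hyperspace X B ->
  (excess A B <= r) <->
  (forall x, A x -> exists2 y, B y & mdist x y <= r).
Proof.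
move=> HA HB; have [x Ax [-> xmax]] := excess_max HA HB; split=> [xr z Az|].
  have [y By [zy _]] := set_dist_min z HB.
  by exists y => //; rewrite -zy (le_trans (xmax _ Az)).
move=> /(_ _ Ax)[y By]; apply: le_trans.
by have [z _ [-> +]] := set_dist_min x HB; apply.
Qed.

Lemma excess_ge0 A B : hyperspace X A -> hyperspace X B -> 0 <= excess A B.
Proof.
move=> HA HB; have [x _ [-> _]] := excess_max HA HB.
by have [y _ [-> _]] := set_dist_min x HB; exact: mdist_ge0.
Qed.

Lemma excess_triangle A B C :
  hyperspace X A -> hyperspace X B -> hyperspace X C ->
  excess A C <= excess A B + excess B C.
Proof.
move=> HA HB HC; apply/excess_le => // x Ax.
have [y By xy] := (excess_le _ HA HB).1 (lexx _) _ Ax.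
have [z Cz yz] := (excess_le _ HB HC).1 (lexx _) _ By.
by exists z => //; rewrite (le_trans (metric_triangle x y z))// lerD.
Qed.

Lemma hausdorff_dist_ge0 A B :
  hyperspace X A -> hyperspace X B -> 0 <= hausdorff_dist A B.
Proof. by move=> HA HB; rewrite le_max excess_ge0. Qed.

Lemma hausdorff_distxx A : hyperspace X A -> hausdorff_dist A A = 0.
Proof.
move=> HA; apply/eqP; rewrite eq_le hausdorff_dist_ge0// andbT.
rewrite /hausdorff_dist maxxx; apply/excess_le => // x Ax.
by exists x; rewrite ?mdistxx.
Qed.

Lemma hausdorff_dist_sym A B : hausdorff_dist A B = hausdorff_dist B A.
Proof. exact: maxC. Qed.

Lemma hausdorff_dist_triangle A B C :
  hyperspace X A -> hyperspace X B -> hyperspace X C ->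
  hausdorff_dist A C <= hausdorff_dist A B + hausdorff_dist B C.
Proof.
move=> HA HB HC; rewrite ge_max; apply/andP; split.
  by rewrite (le_trans (excess_triangle HA HB HC))// lerD// le_max lexx.
rewrite (le_trans (excess_triangle HC HB HA))// addrC lerD// le_max lexx.
all: by rewrite orbT.
Qed.

Lemma hausdorff_dist_le0 A B : hyperspace X A -> hyperspace X B ->
  hausdorff_dist A B <= 0 -> A = B.
Proof.
move=> HA HB; rewrite ge_max => /andP[/(excess_le _ HA HB) AB].
move=> /(excess_le _ HB HA) BA.
have dist0 (x y : X) : mdist x y <= 0 -> x = y.
  by move=> xy; apply: mdist_positivity; apply/eqP; rewrite eq_le xy mdist_ge0.
apply/seteqP; split=> x.
- by move=> /AB[y By /dist0 ->].
- by move=> /BA[y By /dist0 ->].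
Qed.

(* The excess of the images is attained at some [w i x], and [w i] of a point
   nearest to [x] is a competitor. *)
Lemma fractal_op_hausdorff_dist (N : nat) (w : 'I_N -> X -> X) A B :
  (0 < N)%N -> (forall i, continuous (w i)) ->
  hyperspace X A -> hyperspace X B ->
  exists i x y, mdist x y <= hausdorff_dist A B /\
    hausdorff_dist (fractal_op w A) (fractal_op w B) <=
    mdist (w i x) (w i y).
Proof.
move=> N0 wc.
have excessW C D : hyperspace X C -> hyperspace X D ->
    exists i x y, mdist x y <= excess C D /\
      excess (fractal_op w C) (fractal_op w D) <= mdist (w i x) (w i y).
  move=> HC HD.
  have HWC := fractal_op_hyperspace N0 wc HC.
  have HWD := fractal_op_hyperspace N0 wc HD.
  have [_ [i _ [x Cx <-]] [-> _]] := excess_max HWC HWD.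
  have [y Dy xy] := (excess_le _ HC HD).1 (lexx _) _ Cx.
  exists i, x, y; split=> //.
  have [z _ [-> +]] := set_dist_min (w i x) HWD; apply.
  by exists i => //; exists y.
move=> HA HB; rewrite /hausdorff_dist.
have [i [x [y [xy ixy]]]] := excessW _ _ HA HB.
have [j [u [v [uv juv]]]] := excessW _ _ HB HA.
case: (leP (excess (fractal_op w B) _) (excess (fractal_op w A) _)) => _.
- by exists i, x, y; rewrite le_max xy.
- by exists j, u, v; rewrite le_max uv orbT.
Qed.

End hausdorff_distance_theory.

(** * Completeness of the hyperspace *)

Section hyperspace_complete.
Context {R : realType} {X : completeMetricType R}.

(** An ultrafilter containing [T] is Cauchy: if it had no ball of radius [e], it would contain a set
    of points far from all of [K], while [T] stays close to [K]. Completeness gives a limit, which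
    lies in [T] by closedness. *)
Lemma totally_bounded_closed_compact (T : set X) : closed T ->
  (forall e : R, 0 < e -> exists2 K, compact K &
     forall x, T x -> exists2 y, K y & mdist x y <= e) ->
  compact T.
Proof.
move=> cT Tb; rewrite compact_ultra => F UF FT.
have : cvg F.
  apply: cauchy_cvg; apply: (@cauchy_exP R) => e e0.
  have e40 : 0 < e / 4 by rewrite divr_gt0.
  have [K /compact_near_coveringP cK TK] := Tb _ e40.
  apply: contrapT => /forallNP Fball.
  (* Compactness of [K] makes a local fact uniform: a point outside [ball x e] is more than [e / 4]
     away from every point of [ball x (e / 4)]. *)
  have /= Kfar : \forall z \near F, K `<=` (fun x => e / 4 < mdist z x).
    apply: (cK _ F (fun z x => e / 4 < mdist z x)) => x _.
    have Fx : F (~` ball x e).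
      by have [/Fball|] := in_ultra_setVsetC (ball x e) UF.
    exists (ball x (e / 4), ~` ball x e) => /=.
      by split=> //; exact: nbhsx_ballx.
    move=> [y z] [/=]; rewrite !ballEmdist/= => xy /negP; rewrite -leNgt => xz.
    have := metric_triangle x y z; rewrite (metric_sym y z); lra.
  have [z [Tz Kz]] := filter_ex (filterI FT Kfar).
  have [y /Kz + zy] := TK _ Tz.
  by rewrite ltNge zy.
move=> /cvg_ex[p Fp]; exists p; split=> //.
by apply: cT => B /Fp FB; exact: filter_ex (filterI FT FB).
Qed.

(** The union of the [A m] with [m <= n] is compact and approximates the rest: passing from the
    closure to a point of some [A m] costs [e / 2], and moving to [A n] when [m > n] costs another
    [e / 2]. *)
Lemma hausdorff_cauchy_union_compact (A : nat -> set X) :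
  (forall n, hyperspace X (A n)) ->
  (forall e : R, 0 < e -> exists n, forall m, (n <= m)%N ->
     hausdorff_dist (A n) (A m) <= e) ->
  compact (closure (\bigcup_n A n)).
Proof.
move=> HA cauchyA; apply: totally_bounded_closed_compact.
  exact: closed_closure.
move=> e e0; have [|n An] := cauchyA (e / 2); first by rewrite divr_gt0.
exists (\big[setU/set0]_(m < n.+1) A m).
  by apply: bigsetU_compact => m _; exact: (HA m).2.
move=> x /(_ (ball x (e / 2)))[|z [[m _ Amz]]].
  by apply: nbhsx_ballx; rewrite divr_gt0.
rewrite ballEmdist/= -bigcup_mkord => xz.
have [mn|nm] := ltnP m n.+1.
  by exists z; [exists m|lra].
have := An m (ltnW nm); rewrite ge_max => /andP[_].
move=> /(excess_le _ (HA m) (HA n)) /(_ _ Amz)[y Any zy].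
exists y; first by exists n => /=.
have := metric_triangle x z y; lra.
Qed.

(* The limit is [\bigcap_n closure (\bigcup_(m >= n) A m)]; compactness of the
   closed union provides points of it near a given point of [A n], as cluster
   points of sequences of nearby points in the [A m]. *)
Lemma hyperspace_complete (A : nat -> set X) :
  (forall n, hyperspace X (A n)) ->
  (forall e : R, 0 < e -> exists n, forall m, (n <= m)%N ->
     hausdorff_dist (A n) (A m) <= e) ->
  exists2 L, hyperspace X L &
    hausdorff_dist (A n) L @[n --> \oo] --> (0 : R).
Proof.
move=> HA cauchyA; have cT := hausdorff_cauchy_union_compact HA cauchyA.
pose U n := \bigcup_(m in [set m | (n <= m)%N]) A m.
pose L := \bigcap_n closure (U n).
have nearL n e x : (forall m, (n <= m)%N -> hausdorff_dist (A n) (A m) <= e) ->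
    A n x -> exists2 y, L y & mdist x y <= e.
  move=> An Anx.
  (* For [m < n] the value [x] is a mere default; only the tail of [u] matters. *)
  have /choice[u uP] m : exists z, (n <= m)%N -> A m z /\ mdist x z <= e.
    have [nm|_] := leqP n m; last by exists x.
    have := An m nm; rewrite ge_max => /andP[+ _].
    move=> /(excess_le _ (HA n) (HA m)) /(_ _ Anx)[z Amz xz].
    by exists z.
  have uU k : \forall m \near \oo, U k (u m).
    exists (maxn n k) => // m /=; rewrite geq_max => /andP[nm km].
    by exists m => //; have [] := uP m nm.
  have [|y [_ uy]] := cT (u @ \oo) _.
    apply: filterS (uU 0) => z [l _ Al].
    by apply: subset_closure; exists l.
  exists y => [k _ B By|]; first exact: uy (uU k) By.
  apply/ler_addgt0Pr => d d0.
  have [|z [/= xz]] :=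
      uy [set z | mdist x z <= e] (ball y d) _ (nbhsx_ballx _ _ d0).
    by exists n => // m nm /=; have [] := uP m nm.
  rewrite ballEmdist/= => yz.
  have := metric_triangle x z y; rewrite (metric_sym z y); lra.
have HL : hyperspace X L.
  split.
    have [n An] := cauchyA 1 ltr01; have [[x Anx] _] := HA n.
    by have [y Ly _] := nearL _ _ _ An Anx; exists y.
  apply: subclosed_compact cT _.
    by apply: closed_bigI => n _; exact: closed_closure.
  move=> x /(_ 0 I); apply: closureS => y [m _ Amy].
  by exists m.
exists L => //; apply/cvgrPdist_le => e e0.
have e30 : 0 < e / 3 by rewrite divr_gt0.
have [n An] := cauchyA _ e30.
(* A point of [L] is [e / 3]-close to some [A m] with [n <= m], which is [e / 3]-close to [A n]. The
   remaining [e / 3] pays for replacing [A n] by a later set. *)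
have AnL : hausdorff_dist (A n) L <= 2 * (e / 3).
  rewrite ge_max; apply/andP; split; apply/excess_le => // x.
    by move=> /(nearL _ _ _ An)[y Ly xy]; exists y => //; lra.
  move=> /(_ n I) /(_ _ (nbhsx_ballx _ _ e30))[z [[m /= nm Amz]]].
  rewrite ballEmdist/= => xz.
  have := An m nm; rewrite ge_max => /andP[_].
  move=> /(excess_le _ (HA m) (HA n)) /(_ _ Amz)[y Any zy].
  exists y => //; have := metric_triangle x z y; lra.
exists n => // m /= nm; rewrite sub0r normrN ger0_norm ?hausdorff_dist_ge0//.
have := hausdorff_dist_triangle (HA m) (HA n) HL.
by have := An m nm; rewrite (hausdorff_dist_sym (A m) (A n)); lra.
Qed.

End hyperspace_complete.

(** * Meir-Keeler contractions and their orbits *)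

Lemma meir_keeler_cvg0 (R : realType) (a : R^nat) :
  (forall n, 0 <= a n) ->
  (forall n, 0 < a n.+1 -> a n.+1 < a n) ->
  (forall e : R, 0 < e ->
     exists2 d : R, 0 < d & forall n, a n < e + d -> a n.+1 <= e) ->
  a @ \oo --> (0 : R).
Proof.
move=> a0 aS amk.
have a_nincr : {homo a : n m / (n <= m)%N >-> m <= n}.
  apply/nonincreasing_seqP => n.
  by have [an0|/aS/ltW//] := leP (a n.+1) 0; exact: le_trans an0 (a0 n).
have lba : has_lbound (range a) by exists 0 => _ [n _ <-].
have : a @ \oo --> inf (range a) by exact: nonincreasing_cvgn.
have inf_le n : inf (range a) <= a n by apply: ge_inf => //; exists n.
suff -> : inf (range a) = 0 by [].
apply/eqP; rewrite eq_le lb_le_inf ?andbT//; first last.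
- by move=> _ [n _ <-].
- by exists (a 0%N), 0%N.
rewrite leNgt; apply/negP => L0.
(* A positive infimum is impossible: once a term is within [d] of it, the next is at most the
   infimum, and the one after is strictly below, by strict decrease or because it is [0]. *)
have [d d0 amkL] := amk _ L0.
have [|_ [n _ <-] /amkL aL] := inf_adherent d0 (E := range a).
  by split=> //; exists (a 0%N), 0%N.
have := inf_le n.+2; apply/negP; rewrite -ltNge.
have := a0 n.+2; rewrite le_eqVlt => /orP[/eqP <-//|/aS]; lra.
Qed.

Section meir_keeler_ifs.
Context {R : realType} {X : completeMetricType R} (N : nat).
Variable w : 'I_N -> X -> X.
Hypothesis N_gt0 : (0 < N)%N.
Hypothesis w_cont : forall i, continuous (w i).
Hypothesis w_lt : forall i x y,
  0 < mdist (w i x) (w i y) -> mdist (w i x) (w i y) < mdist x y.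
Hypothesis w_mk : forall e : R, 0 < e -> exists2 d : R, 0 < d &
  forall i x y, mdist x y < e + d -> mdist (w i x) (w i y) <= e.

Local Notation W := (fractal_op w).
Implicit Types A B : set X.

Lemma iter_fractal_op_hyperspace A n :
  hyperspace X A -> hyperspace X (iter n W A).
Proof. by move=> HA; elim: n => //= n; exact: fractal_op_hyperspace. Qed.

Lemma fractal_op_lt A B : hyperspace X A -> hyperspace X B ->
  0 < hausdorff_dist (W A) (W B) ->
  hausdorff_dist (W A) (W B) < hausdorff_dist A B.
Proof.
move=> HA HB W0.
have [i [x [y [xy Wxy]]]] := fractal_op_hausdorff_dist N_gt0 w_cont HA HB.
rewrite (le_lt_trans Wxy)// (lt_le_trans _ xy)//.
by apply: w_lt; exact: lt_le_trans Wxy.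
Qed.

Lemma fractal_op_nonexpansive A B : hyperspace X A -> hyperspace X B ->
  hausdorff_dist (W A) (W B) <= hausdorff_dist A B.
Proof.
move=> HA HB; have [W0|/fractal_op_lt H] := leP (hausdorff_dist (W A) (W B)) 0.
  by rewrite (le_trans W0)// hausdorff_dist_ge0.
by rewrite ltW// H.
Qed.

Lemma fractal_op_mk (e : R) : 0 < e -> exists2 d : R, 0 < d & forall A B,
  hyperspace X A -> hyperspace X B -> hausdorff_dist A B < e + d ->
  hausdorff_dist (W A) (W B) <= e.
Proof.
move=> /w_mk[d d0 wd]; exists d => // A B HA HB AB.
have [i [x [y [xy Wxy]]]] := fractal_op_hausdorff_dist N_gt0 w_cont HA HB.
by rewrite (le_trans Wxy)// wd// (le_lt_trans xy).
Qed.

Lemma iter_fractal_op_cvg0 A B : hyperspace X A -> hyperspace X B ->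
  hausdorff_dist (iter n W A) (iter n W B) @[n --> \oo] --> (0 : R).
Proof.
move=> HA HB.
have HWA n := iter_fractal_op_hyperspace n HA.
have HWB n := iter_fractal_op_hyperspace n HB.
apply: meir_keeler_cvg0 => [n|n|e e0].
- exact: hausdorff_dist_ge0.
- by move=> /= W0; exact: fractal_op_lt.
- have [d d0 Wd] := fractal_op_mk e0; exists d => // n /=.
  exact: Wd.
Qed.

(** Once one step of the orbit is shorter than [r], the orbit never leaves the ball of radius
    [e / 2 + r] about [iter n W A]: as [r <= d], [W] brings distances below this radius down to
    [e / 2], and the triangle inequality adds less than [r]. *)
Lemma iter_fractal_op_cauchy A : hyperspace X A ->
  forall e : R, 0 < e -> exists n, forall m, (n <= m)%N ->
    hausdorff_dist (iter n W A) (iter m W A) <= e.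
Proof.
move=> HA e e0; have HWA n := iter_fractal_op_hyperspace n HA.
have e20 : 0 < e / 2 by rewrite divr_gt0.
have [d d0 Wd] := fractal_op_mk e20.
have [r [r0 rd re]] : exists r, [/\ 0 < r, r <= d & r <= e / 2].
  exists (Num.min d (e / 2)).
  by rewrite lt_min d0 e20 !ge_min !lexx orbT.
(* Consecutive iterates are compared as the orbits of [A] and [W A]. *)
have /cvgrPdist_lt /(_ _ r0)[n _ Wn] :=
  iter_fractal_op_cvg0 HA (fractal_op_hyperspace N_gt0 w_cont HA).
have {}Wn : hausdorff_dist (iter n W A) (iter n.+1 W A) < r.
  have := Wn n (leqnn n); rewrite sub0r normrN -iterSr; apply: le_lt_trans.
  exact: ler_norm.
exists n => m /subnKC <-.
suff : hausdorff_dist (iter n W A) (iter (n + (m - n)) W A) < e / 2 + r by lra.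
elim: (m - n)%N => [|k ih].
  by rewrite addn0 hausdorff_distxx ?addr_gt0.
rewrite addnS addrC.
apply: le_lt_trans (hausdorff_dist_triangle _ (HWA n.+1) _) _ => //.
by rewrite ltr_leD//= Wd// (lt_le_trans ih)// lerD2l.
Qed.

Lemma meir_keeler_ifs_attractor : exists Astar : set X,
  unique (is_attractor w) Astar /\
  forall A : set X, hyperspace X A ->
    hausdorff_dist (iter n W A) Astar @[n --> \oo] --> (0 : R).
Proof.
have HA0 : hyperspace X [set point].
  by split; [exists point|exact: compact_set1].
have HW n := iter_fractal_op_hyperspace n HA0.
have [L HL WL] := hyperspace_complete HW (iter_fractal_op_cauchy HA0).
have HWL := fractal_op_hyperspace N_gt0 w_cont HL.
have fixL : W L = L.
  apply: hausdorff_dist_le0 => //; apply/ler_addgt0Pr => e e0; rewrite add0r.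
  have e20 : 0 < e / 2 by rewrite divr_gt0.
  have /cvgrPdist_le /(_ _ e20)[n _ Wn] := WL.
  have WnL m : (n <= m)%N -> hausdorff_dist (iter m W [set point]) L <= e / 2.
    by move=> /Wn; rewrite sub0r normrN; exact: le_trans (ler_norm _).
  have := hausdorff_dist_triangle HWL (HW n.+1) HL.
  have := fractal_op_nonexpansive HL (HW n).
  rewrite (hausdorff_dist_sym L (iter n W _)) -iterS.
  by have := WnL n (leqnn n); have := WnL n.+1 (leqnSn n); lra.
have iter_fix B n : W B = B -> iter n W B = B.
  by move=> fixB; elim: n => //= n ->.
have cvgL A : hyperspace X A ->
    hausdorff_dist (iter n W A) L @[n --> \oo] --> (0 : R).
  move=> HA; rewrite [X in X @ _ --> _](_ : _ =
    fun n => hausdorff_dist (iter n W A) (iter n W L)).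
    exact: iter_fractal_op_cvg0.
  by apply/funext => n; rewrite (iter_fix L).
exists L; split=> //; split=> // B [HB fixB].
apply/esym/hausdorff_dist_le0 => //.
(* The orbit of a fixed set [B] is constant, so its distance to [L] is a constant sequence tending
   to [0]. *)
have := cvgL B HB.
under eq_fun do rewrite iter_fix//.
by move=> /(cvg_unique _ (cvg_cst _)) ->.
Qed.

End meir_keeler_ifs.

Theorem theorem4p3 (R : realType) (X : completeMetricType R) (N : nat)
  (psi : R -> R) (phi : 'I_N -> R -> R) (w : 'I_N -> X -> X)
  (N_gt0 : (0 < N)%N)
  (psi_nd : {in `]0, +oo[ &, nondecreasing_fun psi})
  (phi_nd : forall i, {in `]0, +oo[ &, nondecreasing_fun (phi i)})
  (w_cont : forall i, continuous (w i))
  (w_contr : forall i x y, 0 < mdist (w i x) (w i y) ->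
     psi (mdist (w i x) (w i y)) <= phi i (mdist x y))
  (phi_lt_psi : forall i t, 0 < t -> phi i t < psi t)
  (limsup_phi_lt : forall i (e : R), 0 < e ->
     (limf_esup (fun t => (phi i t)%:E) e^'+
        < (lim (psi t @[t --> e^'+]))%:E)%E) :
  exists Astar : set X,
    unique (is_attractor w) Astar /\
    forall A : set X, hyperspace X A ->
      hausdorff_dist (iter n (fractal_op w) A) Astar @[n --> \oo] --> (0 : R).
Proof.
have w_lt i x y : 0 < mdist (w i x) (w i y) ->
    mdist (w i x) (w i y) < mdist x y.
  move=> wxy0; rewrite ltNge; apply/negP => xy_le.
  have xy0 : 0 < mdist x y.
    by rewrite mdist_gt0; apply: contraTneq wxy0 => ->; rewrite mdistxx ltxx.
  (* Otherwise [psi (d (w x) (w y)) <= phi (d x y) < psi (d x y) <= psi (d (w x) (w y))]. *)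
  have := w_contr i x y wxy0; apply/negP; rewrite -ltNge.
  rewrite (lt_le_trans (phi_lt_psi i _ xy0))// psi_nd ?in_itv/= ?andbT//.
apply: meir_keeler_ifs_attractor => // e e0.
pose l := lim (psi t @[t --> e^'+]).
(* By monotonicity the right limit exists and is the infimum of [psi] over []e, +oo[], where [psi e]
   is a lower bound. *)
have psi_ge t : e < t -> l <= psi t.
  move=> et.
  have ltoo : (BRight e < +oo%O :> itv_bound R)%O by [].
  have lb : has_lbound (psi @` [set` `]e, +oo[]).
    exists (psi e) => _ [s + <-]; rewrite /= in_itv/= andbT => es.
    by rewrite psi_nd ?in_itv/= ?andbT ?(ltW es)// (lt_trans e0).
  have psi_nde : {in `]e, +oo[ &, nondecreasing_fun psi}.
    move=> s u; rewrite !in_itv/= !andbT => es eu.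
    by apply: psi_nd; rewrite in_itv/= andbT (lt_trans e0).
  have /cvg_lim := nondecreasing_at_right_cvgr ltoo psi_nde lb.
  rewrite /l => ->//; apply: ge_inf => //.
  by exists t => //=; rewrite in_itv/= andbT.
(* A limsup below [l] gives a right neighborhood where [phi i] has supremum below [l]; finiteness of
   ['I_N] makes it common to all [i]. *)
have : \forall t \near e^'+, forall i, phi i t < l.
  apply: filter_forall => i.
  have := limsup_phi_lt i e e0; rewrite limf_esupE.
  move=> /ereal_inf_lt[_ [V eV <-]] supV; apply: filterS eV => t Vt; rewrite -lte_fin.
  by apply: le_lt_trans supV; apply: ereal_sup_ubound; exists t.
move=> /nbhs_ballP[d /= d0 phi_lt]; exists d => // i x y xy.
rewrite leNgt; apply/negP => exy.
have xy0 := lt_trans e0 exy.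
(* Strict contraction forces [e < mdist x y], so that [mdist x y] lies in the right neighborhood of
   [e] where [phi i] is below [l]. *)
have exy' := lt_trans exy (w_lt _ _ _ xy0).
have := le_trans (psi_ge _ exy) (w_contr _ _ _ xy0); apply/negP; rewrite -ltNge.
have ed : ball e d (mdist x y) by rewrite /ball/= ltr_distlC; lra.
exact: phi_lt ed exy' i.
Qed.
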